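(* The PPT exact entanglement cost is not generally monogamous. That is, there exist finite-dimensional Hilbert spaces $\mathcal{H}_A,\mathcal{H}_B,\mathcal{H}_C$ and a tripartite state $\rho_{ABC}$ on $\mathcal{H}_A\otimes\mathcal{H}_B\otimes\mathcal{H}_C$ such that $$E_{\mathrm{PPT}}(\rho_{AB})+E_{\mathrm{PPT}}(\rho_{AC})>E_{\mathrm{PPT}}(\rho_{A(BC)}),$$ where $\rho_{AB}=\operatorname{Tr}_C\rho_{ABC}$, $\rho_{AC}=\operatorname{Tr}_B\rho_{ABC}$, and $\rho_{A(BC)}$ denotes $\rho_{ABC}$ regarded as a bipartite state with respect to the cut between $A$ and $BC$.
   Context: A bipartite state $\rho_{AB}$ is a positive semi-definite operator of unit trace on $\mathcal{H}_A\otimes\mathcal{H}_B$. The partial transpose with respect to a fixed orthonormal basis $\{|i\rangle_B\}_i$ is the linear map $T_B(X_{AB})=X_{AB}^{T_B}:=\sum_{i,j}(I_A\otimes|i\rangle\langle j|_B)X_{AB}(I_A\otimes|i\rangle\langle j|_B)$. A quantum channel is a completely positive trace-preserving map. A bipartite channel $\mathcal{N}_{AB\to A'B'}$ (Alice holds $A,A'$, Bob holds $B,B'$) is completely PPT-preserving (C-PPT-P), written $\mathcal{N}\in\mathrm{PPT}$, if $T_{B'}\circ\mathcal{N}_{AB\to A'B'}\circ T_B$ is completely positive. For $d\in\mathbb{N}=\{1,2,\dots\}$, the maximally entangled state of Schmidt rank $d$ is $\Phi^d_{\hat A\hat B}:=\frac1d\sum_{i,j=1}^d|i\rangle\langle j|_{\hat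 A}\otimes|i\rangle\langle j|_{\hat B}$, where $\hat A,\hat B$ have dimension $d$ with orthonormal bases $\{|i\rangle_{\hat A}\}_i$, $\{|i\rangle_{\hat B}\}_i$. One-shot PPT exact entanglement cost: $E^{(1)}_{\mathrm{PPT}}(\rho_{AB}):=\inf\{\log_2 d: d\in\mathbb{N},\ \Lambda_{\hat A\hat B\to AB}\in\mathrm{PPT},\ \rho_{AB}=\Lambda_{\hat A\hat B\to AB}(\Phi^d_{\hat A\hat B})\}$. PPT exact entanglement cost: $E_{\mathrm{PPT}}(\rho_{AB}):=\limsup_{n\to\infty}\frac1n E^{(1)}_{\mathrm{PPT}}(\rho_{AB}^{\otimes n})$, where $\rho_{AB}^{\otimes n}$ is regarded as bipartite with respect to the cut $A^n|B^n$. An entanglement measure $E$ is monogamous if $E(\rho_{AB})+E(\rho_{AC})\le E(\rho_{A(BC)})$ for all tripartite states $\rho_{ABC}$. *)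

(* Defs.v *)
From HB Require Import structures.
From mathcomp Require Import all_boot all_order all_algebra.
From mathcomp Require Export complex mxtens.
From mathcomp Require Import all_classical all_reals all_analysis.

Set Implicit Arguments.
Unset Strict Implicit.
Unset Printing Implicit Defensive.

Import Order.TTheory GRing.Theory Num.Theory.
Local Open Scope classical_set_scope.
Local Open Scope ring_scope.
Local Open Scope complex_scope.
Local Open Scope sesquilinear_scope.

(* An operator on H_A (x) H_B, with dim H_A = a and dim H_B = b, is a matrix in
   'M_(a * b); the basis vector |i>_A (x) |j>_B has index mxtens_index (i, j),
   which is the convention of the Kronecker product *t. *)

Section Operators.
Variable R : realType.
Local Notation C := R[i].

(* In the order of R[i], 0 <= z means that z is real and nonnegative; hence psd
   implies Hermitian. *)
Definition psd n (X : 'M[C]_n) : Prop :=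
  forall v : 'cV[C]_n, 0 <= (v ^t* *m X *m v) 0 0.

Definition is_state n (rho : 'M[C]_n) : Prop := psd rho /\ \tr rho = 1.

Definition partial_transpose a b (X : 'M[C]_(a * b)) : 'M[C]_(a * b) :=
  \sum_(i < b) \sum_(j < b)
    ((1%:M : 'M[C]_a) *t delta_mx i j) *m X *m
    ((1%:M : 'M[C]_a) *t delta_mx i j).

(* id_k (x) f, written blockwise: sum_ij |i><j| (x) f (X_ij). *)
Definition amplify k m n (f : 'M[C]_m -> 'M[C]_n) (X : 'M[C]_(k * m)) :
    'M[C]_(k * n) :=
  \sum_(i < k) \sum_(j < k) delta_mx i j *t
    f (mxsub (fun p => mxtens_index (i, p)) (fun q => mxtens_index (j, q)) X).

Definition completely_positive m n (f : 'M[C]_m -> 'M[C]_n) : Prop :=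
  linear f /\
  forall (k : nat) (X : 'M[C]_(k * m)), psd X -> psd (amplify f X).

Definition trace_preserving m n (f : 'M[C]_m -> 'M[C]_n) : Prop :=
  forall X, \tr (f X) = \tr X.

Definition quantum_channel m n (f : 'M[C]_m -> 'M[C]_n) : Prop :=
  completely_positive f /\ trace_preserving f.

Definition ppt_channel a b a' b' (f : 'M[C]_(a * b) -> 'M[C]_(a' * b')) : Prop :=
  quantum_channel f /\
  completely_positive
    (fun X => @partial_transpose a' b' (f (@partial_transpose a b X))).

Definition max_entangled d : 'M[C]_(d * d) :=
  d%:R^-1 *: \sum_(i < d) \sum_(j < d) delta_mx i j *t delta_mx i j.

(* The reordering (A A')(B B') -> (A B)(A' B') of tensor factors. *)
Definition regroup a b a' b' (x : 'I_((a * a') * (b * b'))) :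
    'I_((a * b) * (a' * b')) :=
  let: (s, t) := mxtens_unindex x in
  let: (i, i') := mxtens_unindex s in
  let: (j, j') := mxtens_unindex t in
  mxtens_index (mxtens_index (i, j), mxtens_index (i', j')).

(* X_{AB} (x) Y_{A'B'}, as an operator for the cut A A' | B B'. *)
Definition bitens a b a' b' (X : 'M[C]_(a * b)) (Y : 'M[C]_(a' * b')) :
    'M[C]_((a * a') * (b * b')) :=
  mxsub (@regroup a b a' b') (@regroup a b a' b') (X *t Y).

(* rho^{(x) n} for the cut A^n | B^n. The dimensions a ^ n and b ^ n are spelled
   as iterated products because a ^ n.+1 is not convertible to a * a ^ n. *)
Fixpoint bitens_pow a b (rho : 'M[C]_(a * b)) (n : nat) :
    'M[C]_(iter n (muln a) 1%N * iter n (muln b) 1%N) :=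
  match n with
  | 0 => 1%:M
  | n'.+1 => bitens rho (bitens_pow rho n')
  end.

Definition log2 (x : R) : R := ln x / ln 2.

(* Infimum in the extended reals, with inf of the empty set equal to +oo. *)
Definition oneshot_cost a b (rho : 'M[C]_(a * b)) : \bar R :=
  ereal_inf [set c | exists d (Lambda : 'M[C]_(d * d) -> 'M[C]_(a * b)),
    [/\ (0 < d)%N, ppt_channel Lambda, rho = Lambda (max_entangled d)
      & c = (log2 d%:R)%:E]].

(* The term n = 0, where 0^-1 = 0, does not affect the limsup. *)
Definition ppt_cost a b (rho : 'M[C]_(a * b)) : \bar R :=
  limn_esup (fun n => ((n%:R^-1)%:E * oneshot_cost (bitens_pow rho n))%E).

(* Partial traces of an operator on H_A (x) (H_B (x) H_C). *)
Definition trace_C a b c (rho : 'M[C]_(a * (b * c))) : 'M[C]_(a * b) :=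
  \matrix_(x, y)
    let: (i, j) := mxtens_unindex x in
    let: (i', j') := mxtens_unindex y in
    \sum_(k < c) rho (mxtens_index (i, mxtens_index (j, k)))
                     (mxtens_index (i', mxtens_index (j', k))).

Definition trace_B a b c (rho : 'M[C]_(a * (b * c))) : 'M[C]_(a * c) :=
  \matrix_(x, y)
    let: (i, k) := mxtens_unindex x in
    let: (i', k') := mxtens_unindex y in
    \sum_(j < b) rho (mxtens_index (i, mxtens_index (j, k)))
                     (mxtens_index (i', mxtens_index (j, k'))).

End Operators.

(* Main.v *)
(* The state is rho = (1 (x) V) Phi^2 (1 (x) V)^* for the isometry V : A' -> BC with
   V|0> = 3/5 |00> + 4/5 |11> and V|1> = |10>. Across A | BC it is a maximally entangled
   pair of qubits up to the local isometry V, so V^{(x) n} is a PPT channel producing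
   rho^{(x) n} from Phi^{2^n} and the cost is at most 1. Conversely the cost is bounded below
   by the logarithmic negativity, which for the marginals on AB and AC is log2 (34/25) and
   log2 (41/25), and (34/25)(41/25) > 2. *)

Require Import Defs.
From mathcomp Require Import all_boot all_order all_algebra.
From mathcomp Require Import all_classical all_reals all_analysis ring lra.
Local Open Scope ring_scope.
Local Open Scope complex_scope.

Set Implicit Arguments.
Unset Strict Implicit.
Unset Printing Implicit Defensive.

Import Order.TTheory GRing.Theory Num.Theory.
Local Open Scope sesquilinear_scope.

Section Cost.
Variable R : realType.
Local Notation C := R[i].

(** * Index calculus for Kronecker products and local operators *)

Lemma sum_mxtens (V : nmodType) m n (F : 'I_(m * n) -> V) :
  \sum_x F x = \sum_i \sum_j F (mxtens_index (i, j)).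
Proof.
rewrite pair_big /= (reindex (@mxtens_index m n)) /=.
  by apply: eq_bigr => -[].
exists (@mxtens_unindex m n) => x _; first exact: mxtens_indexK.
exact: mxtens_unindexK.
Qed.

Lemma eq_mxtens m n (A B : 'M[C]_(m * n)) :
  (forall i j k l, A (mxtens_index (i, j)) (mxtens_index (k, l)) =
                   B (mxtens_index (i, j)) (mxtens_index (k, l))) -> A = B.
Proof.
move=> eqAB; apply/matrixP => x y.
by case: (mxtens_indexP x) => i j; case: (mxtens_indexP y).
Qed.

Lemma adjmxM m n p (A : 'M[C]_(m, n)) (B : 'M[C]_(n, p)) :
  (A *m B)^t* = B^t* *m A^t*.
Proof. by rewrite trmx_mul map_mxM. Qed.

Lemma adjmx1 n : (1%:M : 'M[C]_n)^t* = 1%:M.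
Proof. by rewrite trmx1 map_mx1. Qed.

Lemma adj_tensmx m n p q (A : 'M[C]_(m, n)) (B : 'M[C]_(p, q)) :
  (A *t B)^t* = A^t* *t B^t*.
Proof. by rewrite trmx_tens map_mxT. Qed.

Lemma tens1mx1 m n : (1%:M : 'M[C]_m) *t (1%:M : 'M[C]_n) = 1%:M.
Proof.
apply: eq_mxtens => i j k l; rewrite tensmxE !mxE -natrM mulnb.
by rewrite (can_eq (@mxtens_indexK m n)).
Qed.

Lemma sum_pick n (F : 'I_n -> C) k : \sum_i (i == k)%:R * F i = F k.
Proof.
rewrite (bigD1 k) //= eqxx mul1r big1 ?addr0 // => i /negPf ->.
by rewrite mul0r.
Qed.

Lemma sum_pick_sym n (F : 'I_n -> C) k : \sum_i (k == i)%:R * F i = F k.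
Proof. by under eq_bigr do rewrite eq_sym; exact: sum_pick. Qed.

Lemma tens1_mulE k m n (K : 'M[C]_(m, n)) p (X : 'M[C]_(k * n, p)) i j y :
  ((1%:M *t K) *m X) (mxtens_index (i, j)) y =
  \sum_r K j r * X (mxtens_index (i, r)) y.
Proof.
rewrite mxE sum_mxtens exchange_big; apply: eq_bigr => r _.
under eq_bigr do rewrite tensmxE mxE -mulrA.
exact: sum_pick_sym (fun l => K j r * X (mxtens_index (l, r)) y) i.
Qed.

Lemma mul_tens1E k m n (K : 'M[C]_(m, n)) p (X : 'M[C]_(p, k * m)) i j y :
  (X *m (1%:M *t K)) y (mxtens_index (i, j)) =
  \sum_r X y (mxtens_index (i, r)) * K r j.
Proof.
rewrite mxE sum_mxtens exchange_big; apply: eq_bigr => r _.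
under eq_bigr do rewrite tensmxE mxE mulrCA.
exact: (sum_pick (fun l => X y (mxtens_index (l, r)) * K r j)).
Qed.

Lemma local_conjE k m n (K : 'M[C]_(m, n)) (X : 'M[C]_(k * n)) i p j q :
  ((1%:M *t K) *m X *m (1%:M *t K)^t*) (mxtens_index (i, p)) (mxtens_index (j, q)) =
  \sum_s \sum_r K p r * X (mxtens_index (i, r)) (mxtens_index (j, s)) * (K q s)^*.
Proof.
rewrite adj_tensmx adjmx1 mul_tens1E; apply: eq_bigr => s _.
by rewrite tens1_mulE mulr_suml; apply: eq_bigr => r _; rewrite !mxE.
Qed.

(** * Partial transpose *)

Lemma partial_transposeE a b (X : 'M[C]_(a * b)) i j i' j' :
  partial_transpose X (mxtens_index (i, j)) (mxtens_index (i', j')) =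
  X (mxtens_index (i, j')) (mxtens_index (i', j)).
Proof.
rewrite /partial_transpose summxE.
transitivity (\sum_k \sum_l (j == k)%:R * ((j' == l)%:R *
    X (mxtens_index (i, l)) (mxtens_index (i', k)))).
  apply: eq_bigr => k _; rewrite summxE; apply: eq_bigr => l _.
  rewrite mul_tens1E (bigD1 k) //= big1 ?addr0; last first.
    by move=> r /negPf nrk; rewrite [delta_mx _ _ _ _]mxE nrk mulr0.
  rewrite [delta_mx _ _ _ _]mxE eqxx /= mulrC tens1_mulE (bigD1 l) //= big1 ?addr0; last first.
    by move=> r /negPf nrl; rewrite [delta_mx _ _ _ _]mxE nrl andbF mul0r.
  by rewrite [delta_mx _ _ _ _]mxE eqxx andbT mulrCA.
under eq_bigr do rewrite -mulr_sumr sum_pick_sym.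
exact: sum_pick_sym (fun k => X (mxtens_index (i, j')) (mxtens_index (i', k))) j.
Qed.

Lemma partial_transposeK a b : involutive (@partial_transpose R a b).
Proof. by move=> X; apply: eq_mxtens => i j k l; rewrite !partial_transposeE. Qed.

Lemma partial_transposeZ a b c (X : 'M[C]_(a * b)) :
  partial_transpose (c *: X) = c *: partial_transpose X.
Proof. by apply: eq_mxtens => i j k l; rewrite partial_transposeE !mxE partial_transposeE. Qed.

Lemma partial_transpose1 a b : partial_transpose (1%:M : 'M[C]_(a * b)) = 1%:M.
Proof.
apply: eq_mxtens => i j k l; rewrite partial_transposeE -tens1mx1 !tensmxE !mxE.
by rewrite (eq_sym l).
Qed.

Lemma tr_partial_transpose a b (X : 'M[C]_(a * b)) :
  \tr (partial_transpose X) = \tr X.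
Proof.
rewrite /mxtrace !sum_mxtens; apply: eq_bigr => i _; apply: eq_bigr => j _.
by rewrite partial_transposeE.
Qed.

(** In general the partial transpose replaces a local Kraus operator on Bob's side by its entrywise
    conjugate; a real [K] equals its conjugate, so conjugation by it commutes with the transpose. *)
Lemma partial_transpose_local k m n (K : 'M[C]_(m, n)) (X : 'M[C]_(k * n)) :
  (forall i j, K i j \is Num.real) ->
  partial_transpose ((1%:M *t K) *m X *m (1%:M *t K)^t*) =
  (1%:M *t K) *m partial_transpose X *m (1%:M *t K)^t*.
Proof.
move=> Kreal; apply: eq_mxtens => i p j q.
rewrite partial_transposeE !local_conjE exchange_big.
apply: eq_bigr => r _; apply: eq_bigr => s _.
by rewrite partial_transposeE !conj_Creal // mulrC mulrA mulrAC.
Qed.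

(** * Tensor products regrouped along the cut *)

Lemma bitensE a b a' b' (X : 'M[C]_(a * b)) (Y : 'M[C]_(a' * b')) i i' j j' k k' l l' :
  bitens X Y (mxtens_index (mxtens_index (i, i'), mxtens_index (j, j')))
             (mxtens_index (mxtens_index (k, k'), mxtens_index (l, l'))) =
  X (mxtens_index (i, j)) (mxtens_index (k, l)) *
  Y (mxtens_index (i', j')) (mxtens_index (k', l')).
Proof. by rewrite /bitens mxE /regroup !mxtens_indexK tensmxE. Qed.

Lemma eq_bimxtens a b a' b' (A B : 'M[C]_((a * a') * (b * b'))) :
  (forall i i' j j' k k' l l',
     A (mxtens_index (mxtens_index (i, i'), mxtens_index (j, j')))
       (mxtens_index (mxtens_index (k, k'), mxtens_index (l, l'))) =
     B (mxtens_index (mxtens_index (i, i'), mxtens_index (j, j')))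
       (mxtens_index (mxtens_index (k, k'), mxtens_index (l, l')))) -> A = B.
Proof.
move=> eqAB; apply: eq_mxtens => i j k l.
case: (mxtens_indexP i) => ? ?; case: (mxtens_indexP j) => ? ?.
by case: (mxtens_indexP k) => ? ?; case: (mxtens_indexP l).
Qed.

Lemma sum_bimxtens a b a' b' (F : 'I_((a * a') * (b * b')) -> C) :
  \sum_x F x = \sum_i \sum_j \sum_i' \sum_j'
    F (mxtens_index (mxtens_index (i, i'), mxtens_index (j, j'))).
Proof.
rewrite !sum_mxtens; apply: eq_bigr => i _.
under eq_bigr do rewrite sum_mxtens.
exact: exchange_big.
Qed.

Lemma bitens_mul a b a' b' (X Y : 'M[C]_(a * b)) (X' Y' : 'M[C]_(a' * b')) :
  bitens X X' *m bitens Y Y' = bitens (X *m Y) (X' *m Y').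
Proof.
apply: eq_bimxtens => i i' j j' k k' l l'.
rewrite bitensE !mxE sum_bimxtens !sum_mxtens mulr_suml.
apply: eq_bigr => r _; rewrite mulr_suml; apply: eq_bigr => s _.
rewrite mulr_sumr; apply: eq_bigr => r' _; rewrite mulr_sumr.
by apply: eq_bigr => s' _; rewrite !bitensE mulrACA.
Qed.

Lemma tr_bitens a b a' b' (X : 'M[C]_(a * b)) (Y : 'M[C]_(a' * b')) :
  \tr (bitens X Y) = \tr X * \tr Y.
Proof.
rewrite /mxtrace sum_bimxtens !sum_mxtens mulr_suml.
apply: eq_bigr => r _; rewrite mulr_suml; apply: eq_bigr => s _.
rewrite mulr_sumr; apply: eq_bigr => r' _; rewrite mulr_sumr.
by apply: eq_bigr => s' _; rewrite !bitensE.
Qed.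

Lemma adj_bitens a b a' b' (X : 'M[C]_(a * b)) (Y : 'M[C]_(a' * b')) :
  (bitens X Y)^t* = bitens (X^t*) (Y^t*).
Proof.
by apply: eq_bimxtens => *; rewrite bitensE [LHS]mxE [(_^T)%R _ _]mxE bitensE rmorphM !mxE.
Qed.

Lemma partial_transpose_bitens a b a' b' (X : 'M[C]_(a * b)) (Y : 'M[C]_(a' * b')) :
  partial_transpose (bitens X Y) = bitens (partial_transpose X) (partial_transpose Y).
Proof.
by apply: eq_bimxtens => *; rewrite partial_transposeE !bitensE !partial_transposeE.
Qed.

Lemma bitens1 a b a' b' :
  bitens (1%:M : 'M[C]_(a * b)) (1%:M : 'M[C]_(a' * b')) = 1%:M.
Proof.
apply: eq_bimxtens => *; rewrite bitensE -!tens1mx1 !tensmxE.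
by rewrite mulrACA.
Qed.

(** * Positivity and reflections *)

Lemma psd_conj m n (K : 'M[C]_(m, n)) (X : 'M[C]_n) :
  psd X -> psd (K *m X *m K^t*).
Proof.
by move=> psdX v; have := psdX (K^t* *m v); rewrite adjmxM trmxCK !mulmxA.
Qed.

Lemma psd1 n : psd (1%:M : 'M[C]_n).
Proof.
move=> v; rewrite mulmx1 mxE; apply: sumr_ge0 => i _.
by rewrite !mxE mulrC mul_conjC_ge0.
Qed.

Lemma psdZ n c (X : 'M[C]_n) : 0 <= c -> psd X -> psd (c *: X).
Proof.
by move=> c_ge0 psdX v; rewrite -scalemxAr -scalemxAl mxE mulr_ge0.
Qed.

Lemma psd_diag_ge0 n (X : 'M[C]_n) i : psd X -> 0 <= X i i.
Proof.
move=> /(_ (delta_mx i 0)); rewrite trmx_delta map_delta_mx -rowE.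
by rewrite -colE !mxE.
Qed.

Lemma psd_tr_ge0 n (X : 'M[C]_n) : psd X -> 0 <= \tr X.
Proof. by move=> psdX; apply: sumr_ge0 => i _; exact: psd_diag_ge0. Qed.

(** [1 + U] is twice the projector onto the +1 eigenspace of [U]. This writes it, up to the factor
    2, in the form K^* K from which positivity is read off. *)
Lemma reflection_plus1 n (U : 'M[C]_n) : U^t* = U -> U *m U = 1%:M ->
  (1%:M + U)^t* *m (1%:M + U) = 2%:R *: (1%:M + U).
Proof.
move=> Uh UU; rewrite [(_ + _)^T]linearD /= map_mxD adjmx1 Uh mulmxDl mul1mx mulmxDr mulmx1 UU.
by rewrite (addrC U) scaler_nat mulr2n.
Qed.

Lemma psd_reflection n (U : 'M[C]_n) : U^t* = U -> U *m U = 1%:M -> psd (1%:M + U).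
Proof.
move=> Uh UU; rewrite -[_ + _](@scalerK _ _ 2%:R) ?pnatr_eq0 // -reflection_plus1 //.
apply: psdZ; first by rewrite invr_ge0 ler0n.
by have := psd_conj ((1%:M + U)^t*) (@psd1 n); rewrite mulmx1 trmxCK.
Qed.

Lemma tr_reflection_ge0 n (U Y : 'M[C]_n) : U^t* = U -> U *m U = 1%:M -> psd Y ->
  0 <= \tr Y + \tr (U *m Y).
Proof.
move=> Uh UU psdY; rewrite -{1}(mul1mx Y) -linearD /= -mulmxDl.
rewrite -[1%:M + U](@scalerK _ _ 2%:R) ?pnatr_eq0 // -reflection_plus1 //.
rewrite -scalemxAl linearZ /= mulr_ge0 ?invr_ge0 ?ler0n //.
by rewrite -mulmxA mxtrace_mulC; apply/psd_tr_ge0/psd_conj.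
Qed.

Lemma reflectionN n (U : 'M[C]_n) : U^t* = U -> U *m U = 1%:M ->
  (- U)^t* = - U /\ (- U) *m (- U) = 1%:M.
Proof. by move=> Uh UU; rewrite [(- _)^T]linearN /= map_mxN Uh mulmxN mulNmx opprK. Qed.

(** * Completely positive maps *)

Lemma amplifyE k m n (f : 'M[C]_m -> 'M[C]_n) (X : 'M[C]_(k * m)) i p j q :
  amplify f X (mxtens_index (i, p)) (mxtens_index (j, q)) =
  f (mxsub (fun r => mxtens_index (i, r)) (fun s => mxtens_index (j, s)) X) p q.
Proof.
rewrite /amplify summxE (bigD1 i) //= [X in _ + X]big1 ?addr0; last first.
  move=> i' /negPf ni; rewrite summxE big1 // => j' _.
  by rewrite tensmxE mxE eq_sym ni mul0r.
rewrite summxE (bigD1 j) //= big1 ?addr0; last first.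
  by move=> j' /negPf nj; rewrite tensmxE mxE (eq_sym j) nj andbF mul0r.
by rewrite tensmxE mxE !eqxx mul1r.
Qed.

(** With a single Kraus operator, the amplified map is again a conjugation, by [1 *t K]. *)
Lemma completely_positive_conj m n (K : 'M[C]_(n, m)) :
  completely_positive (fun X => K *m X *m K^t*).
Proof.
split=> [c X Y|k X psdX]; first by rewrite mulmxDr mulmxDl -scalemxAr -scalemxAl.
suff -> : amplify (fun Z => K *m Z *m K^t*) X =
    (1%:M *t K) *m X *m (1%:M *t K)^t* by exact: psd_conj.
apply: eq_mxtens => i p j q; rewrite amplifyE local_conjE mxE.
apply: eq_bigr => s _; rewrite mxE mulr_suml.
by apply: eq_bigr => r _; rewrite !mxE.
Qed.

Lemma psd_castmx m n (e e' : m = n) (X : 'M[C]_m) : psd (castmx (e, e') X) <-> psd X.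
Proof. by case: n / e e' => e'; rewrite castmx_id. Qed.

(** Positivity is the case k = 1 of complete positivity; the casts bridge the dimensions 1 * m and
    m. *)
Lemma completely_positive_psd m n (f : 'M[C]_m -> 'M[C]_n) X :
  completely_positive f -> psd X -> psd (f X).
Proof.
move=> [_ /(_ 1%N (1 *t X))]; rewrite tens_scalar1mx psd_castmx => fpos /fpos.
have -> : amplify f (castmx (esym (mul1n m), esym (mul1n m)) X) = 1 *t f X.
  apply: eq_mxtens => i p j q; rewrite amplifyE tensmxE !ord1 mxE mul1r.
  congr (f _ p q); apply/matrixP => r s.
  by rewrite mxE -tens_scalar1mx tensmxE mxE mul1r.
by rewrite tens_scalar1mx psd_castmx.
Qed.

(** * The swap operator and the bound on witnesses after a PPT channel *)

Definition swap d : 'M[C]_(d * d) :=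
  partial_transpose (d%:R *: max_entangled R d).

Lemma swapE d i j k l :
  swap d (mxtens_index (i, j)) (mxtens_index (k, l)) = ((i == l) && (j == k))%:R.
Proof.
rewrite partial_transposeE /max_entangled.
have d0 : d%:R != 0 :> C by rewrite pnatr_eq0 -lt0n (leq_ltn_trans _ (ltn_ord i)).
rewrite scalerA divff // scale1r summxE (bigD1 i) //= [X in _ + X]big1 ?addr0; last first.
  move=> i' /negPf ni; rewrite summxE big1 // => j' _.
  by rewrite tensmxE mxE eq_sym ni mul0r.
rewrite summxE (bigD1 k) //= big1 ?addr0; last first.
  by move=> j' /negPf nj; rewrite tensmxE mxE (eq_sym k) nj andbF mul0r.
by rewrite tensmxE !mxE !eqxx mul1r eq_sym.
Qed.

Lemma swap_adj d : (swap d)^t* = swap d.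
Proof.
apply: eq_mxtens => i j k l; rewrite mxE [(_^T)%R _ _]mxE !swapE rmorph_nat.
by rewrite andbC (eq_sym l) (eq_sym k).
Qed.

Lemma swap_swap d : swap d *m swap d = 1%:M.
Proof.
apply: eq_mxtens => i j k l; rewrite mxE sum_mxtens.
under eq_bigr do under eq_bigr do rewrite !swapE.
transitivity (\sum_r \sum_s (i == s)%:R *
    ((j == r)%:R * ((r == l) && (s == k))%:R : C)).
  apply: eq_bigr => r _; apply: eq_bigr => s _.
  by rewrite -mulnb natrM mulrA.
under eq_bigr => r _.
  rewrite (sum_pick_sym (fun s => (j == r)%:R * ((r == l) && (s == k))%:R)).
  over.
rewrite (sum_pick_sym (fun r => ((r == l) && (i == k))%:R)) -tens1mx1 tensmxE !mxE -natrM mulnb.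
by rewrite andbC.
Qed.

Lemma mxtraceN n (A : 'M[C]_n) : \tr (- A) = - \tr A.
Proof. by rewrite -scaleN1r mxtraceZ mulN1r. Qed.

(* The swap is [d] times the partial transpose of the maximally entangled state. As a
   reflection it is a difference of positive parts [1 +/- swap] whose sum is a multiple of
   the identity, so the positive map [T o Lambda o T] cannot raise its trace norm. *)
Lemma ppt_channel_witness_le a b d (Lambda : 'M[C]_(d * d) -> 'M[C]_(a * b))
    (W : 'M[C]_(a * b)) :
  (0 < d)%N -> ppt_channel Lambda -> W^t* = W -> W *m W = 1%:M ->
  \tr (W *m partial_transpose (Lambda (max_entangled R d))) <= d%:R.
Proof.
move=> d_gt0 [[_ trL]]; have d_neq0 : d%:R != 0 :> C by rewrite pnatr_eq0 -lt0n.
set M := (fun X => _) => Mcp Wh WW.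
have M0 : M 0 = 0 by have := Mcp.1 (-1) 0 0; rewrite scaler0 addr0 scaleN1r addNr.
have MZ c X : M (c *: X) = c *: M X by have := Mcp.1 c X 0; rewrite M0 !addr0.
have MD X Y : M (X + Y) = M X + M Y by have := Mcp.1 1 X Y; rewrite !scale1r.
have MN X : M (- X) = - M X by rewrite -scaleN1r MZ scaleN1r.
have trM X : \tr (M X) = \tr X.
  by rewrite tr_partial_transpose trL tr_partial_transpose.
(* As T is an involution, T (Lambda Phi) = M (T Phi) with M = T o Lambda o T. *)
have -> : partial_transpose (Lambda (max_entangled R d)) =
    M (partial_transpose (max_entangled R d)) by rewrite /M partial_transposeK.
clearbody M; have -> : partial_transpose (max_entangled R d) = d%:R^-1 *: swap d.
  by rewrite /swap partial_transposeZ scalerK.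
rewrite MZ.
have [WNh WNN] := reflectionN Wh WW.
have [Fh FF] := reflectionN (swap_adj d) (swap_swap d).
have psdP := completely_positive_psd Mcp (psd_reflection (swap_adj d) (swap_swap d)).
have psdQ := completely_positive_psd Mcp (psd_reflection Fh FF).
(* With F the swap, these are tr ((1 - W) M(1 + F)) >= 0 and tr ((1 + W) M(1 - F)) >= 0. In their
   sum the terms tr M(F) and tr (W M(1)) cancel, leaving 2 (d^2 - tr (W M(F))) >= 0. *)
have := addr_ge0 (tr_reflection_ge0 WNh WNN psdP) (tr_reflection_ge0 Wh WW psdQ).
rewrite -scalemxAr mxtraceZ !mulNmx !MD !MN !mulmxDr !mulmxN !mxtraceN !mxtraceD !mxtraceN.
rewrite [\tr (M 1%:M)]trM mxtrace1 natrM.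
set t := \tr (W *m M (swap d)); set s := \tr (M (swap d)).
set r := \tr (W *m M 1%:M) => ge0.
have : 0 <= 2%:R * (d%:R * d%:R - t).
  by apply: (le_trans ge0); rewrite le_eqVlt; apply/orP; left; apply/eqP; ring.
rewrite pmulr_rge0 ?ltr0n // subr_ge0 => le_t.
by rewrite ler_pdivrMl // lt_def d_neq0 ler0n.
Qed.

(** * Tensor powers of a witness and the lower bound on the cost *)

Lemma bitens_pow_reflection a b (W : 'M[C]_(a * b)) n :
  W^t* = W -> W *m W = 1%:M ->
  (bitens_pow W n)^t* = bitens_pow W n /\ bitens_pow W n *m bitens_pow W n = 1%:M.
Proof.
move=> Wh WW; elim: n => [|n [IHh IHn]] /=; first by rewrite adjmx1 mulmx1.
by rewrite adj_bitens bitens_mul Wh WW IHh IHn bitens1.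
Qed.

(** Multiplicativity of the witness value makes its logarithm grow linearly in n, so the single-copy
    bound survives the regularization. *)
Lemma tr_bitens_pow a b (W rho : 'M[C]_(a * b)) n :
  \tr (bitens_pow W n *m partial_transpose (bitens_pow rho n)) =
  \tr (W *m partial_transpose rho) ^+ n.
Proof.
elim: n => [|n IHn] /=; first by rewrite partial_transpose1 mulmx1 mxtrace1.
by rewrite partial_transpose_bitens bitens_mul tr_bitens IHn exprS.
Qed.

(** The bound is asked for at positive indices only, since the term of [ppt_cost] at 0 is 0 and may
    lie below [l]; every tail contains a positive index. *)
Lemma limn_esup_ge (u : (\bar R)^nat) l :
  (forall n, (l <= u n.+1)%E) -> (l <= limn_esup u)%E.
Proof.
move=> le_u; rewrite limn_esup_lim; apply: lime_ge; first exact: is_cvg_esups.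
apply: nearW => n; apply: le_trans (le_u n) _.
by apply: ereal_sup_ubound; exists n.+1 => //=.
Qed.

Lemma limn_esup_le (u : (\bar R)^nat) l :
  (forall n, (u n <= l)%E) -> (limn_esup u <= l)%E.
Proof.
move=> u_le; rewrite limn_esup_lim; apply: lime_le; first exact: is_cvg_esups.
by apply: nearW => n; apply: ge_ereal_sup => _ [m _ <-].
Qed.

Lemma ln2_gt0 : 0 < ln 2 :> R.
Proof. by rewrite ln_gt0 // ltr1n. Qed.

Lemma EFin_invn_mulK n (x : R) :
  x%:E = ((n.+1%:R^-1)%:E * (n.+1%:R * x)%:E)%E.
Proof. by rewrite -EFinM mulKf ?pnatr_eq0. Qed.

(* The cost is at least the logarithmic negativity; [W] is the sign of the partial
   transpose of [rho] in the applications. *)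
Lemma ppt_cost_ge a b (rho W : 'M[C]_(a * b)) (t : R) :
  0 < t -> W^t* = W -> W *m W = 1%:M ->
  \tr (W *m partial_transpose rho) = t%:C ->
  ((log2 t)%:E <= ppt_cost rho)%E.
Proof.
move=> t_gt0 Wh WW trW; apply: limn_esup_ge => n.
rewrite (EFin_invn_mulK n (log2 t)).
apply: lee_wpmul2l; first by rewrite lee_fin invr_ge0 ler0n.
apply/ereal_infP => _ [d [Lambda [d_gt0 Lppt rhoE ->]]].
have [Wnh WnWn] := bitens_pow_reflection n.+1 Wh WW.
have := ppt_channel_witness_le d_gt0 Lppt Wnh WnWn.
rewrite -rhoE tr_bitens_pow trW -rmorphXn -(rmorph_nat (real_complex R)) lecR => le_d.
rewrite lee_fin /log2 mulrA ler_wpM2r ?invr_ge0 ?(ltW ln2_gt0) //.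
by rewrite mulr_natl -lnXn // ler_ln ?posrE ?exprn_gt0 ?ltr0n.
Qed.

(** * Local isometries and the upper bound on the cost *)

Section Isometry.
Variables (a b : nat) (V : 'M[C]_(b, a)).
Hypotheses (Vreal : forall i j, V i j \is Num.real) (Viso : V^t* *m V = 1%:M).

(** Since [V] is real, conjugation by [1 *t V] commutes with the partial transpose, so T o f o T is
    f itself and the PPT condition reduces to complete positivity of f. *)
Lemma ppt_channel_isometry k :
  @ppt_channel R k a k b (fun X => (1%:M *t V) *m X *m (1%:M *t V)^t*).
Proof.
split; first split; first exact: completely_positive_conj.
  move=> X; rewrite mxtrace_mulC mulmxA adj_tensmx adjmx1 tensmx_mul Viso.
  by rewrite mulmx1 tens1mx1 mul1mx.
rewrite [X in completely_positive X](_ : _ = fun X => (1%:M *t V) *m X *m (1%:M *t V)^t*).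
  exact: completely_positive_conj.
by apply/funext => X; rewrite partial_transpose_local ?partial_transposeK.
Qed.

(** Obtained by undoing the partial transpose in [swapE]. *)
Lemma max_entangledE d i j k l :
  max_entangled R d (mxtens_index (i, j)) (mxtens_index (k, l)) =
  d%:R^-1 * ((i == j) && (k == l))%:R.
Proof.
have d0 : d%:R != 0 :> C by rewrite pnatr_eq0 -lt0n (leq_ltn_trans _ (ltn_ord i)).
rewrite -[max_entangled R d](scalerK d0) -(partial_transposeK (d%:R *: _)).
by rewrite mxE partial_transposeE -/(swap d) swapE (eq_sym l).
Qed.

Definition isometric_state : 'M[C]_(a * b) :=
  (1%:M *t V) *m max_entangled R a *m (1%:M *t V)^t*.

Lemma isometric_stateE i j k l :
  isometric_state (mxtens_index (i, j)) (mxtens_index (k, l)) =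
  a%:R^-1 * V j i * V l k.
Proof.
rewrite /isometric_state local_conjE (bigD1 k) //= [X in _ + X]big1 ?addr0; last first.
  move=> s /negPf ns; rewrite big1 // => r _.
  by rewrite max_entangledE (eq_sym k) ns andbF !mulr0 mul0r.
rewrite (bigD1 i) //= big1 ?addr0; last first.
  by move=> r /negPf nr; rewrite max_entangledE (eq_sym i) nr !mulr0 mul0r.
by rewrite max_entangledE !eqxx mulr1 conj_Creal // (mulrC (V j i)).
Qed.

End Isometry.

(** The dimensions are iterated products so as to match the type of [bitens_pow]. *)
Fixpoint tens_pow a b (V : 'M[C]_(b, a)) n :
    'M[C]_(iter n (muln b) 1%N, iter n (muln a) 1%N) :=
  if n is n'.+1 then V *t tens_pow V n' else 1%:M.

Lemma tens_pow_real a b (V : 'M[C]_(b, a)) n :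
  (forall i j, V i j \is Num.real) -> forall i j, tens_pow V n i j \is Num.real.
Proof.
move=> Vreal; elim: n => [|n IHn] /= i j; first by rewrite mxE realn.
by rewrite mxE realM.
Qed.

Lemma tens_pow_isometry a b (V : 'M[C]_(b, a)) n :
  V^t* *m V = 1%:M -> (tens_pow V n)^t* *m tens_pow V n = 1%:M.
Proof.
move=> Viso; elim: n => [|n IHn] /=; first by rewrite adjmx1 mulmx1.
by rewrite adj_tensmx tensmx_mul Viso IHn tens1mx1.
Qed.

(** After regrouping, n copies of Phi^a are Phi^(a^n); entrywise, both the normalizations and the
    entries of the isometries multiply. *)
Lemma bitens_pow_isometric_state a b (V : 'M[C]_(b, a)) n :
  (forall i j, V i j \is Num.real) ->
  bitens_pow (isometric_state V) n = isometric_state (tens_pow V n).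
Proof.
move=> Vreal; elim: n => [|n IHn] /=.
  apply: eq_mxtens => i j k l; rewrite isometric_stateE => [|? ?]; last by rewrite mxE realn.
  by rewrite -tens1mx1 tensmxE !mxE !ord1 !eqxx !mulr1 invr1.
apply: (@eq_bimxtens a b (iter n (muln a) 1%N) (iter n (muln b) 1%N)) => i i' j j' k k' l l'.
rewrite bitensE IHn !isometric_stateE //; last 2 first.
- exact: (@tens_pow_real _ _ _ n.+1).
- exact: tens_pow_real.
rewrite !tensmxE natrM invfM; ring.
Qed.

Lemma iter_muln a n : iter n (muln a) 1%N = (a ^ n)%N.
Proof. by elim: n => //= n ->; rewrite expnS. Qed.

Lemma ppt_cost_isometric_state_le a b (V : 'M[C]_(b, a)) :
  (0 < a)%N -> (forall i j, V i j \is Num.real) -> V^t* *m V = 1%:M ->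
  (ppt_cost (isometric_state V) <= (log2 a%:R)%:E)%E.
Proof.
move=> a_gt0 Vreal Viso; apply: limn_esup_le => -[|n].
  (* The term at n = 0 is 0, and log2 a >= 0 because a >= 1. *)
  by rewrite invr0 mul0e lee_fin /log2 divr_ge0 ?ln_ge0 ?ler1n ?(ltW ln2_gt0).
rewrite (EFin_invn_mulK n (log2 a%:R)).
apply: lee_wpmul2l; first by rewrite lee_fin invr_ge0 ler0n.
apply: ereal_inf_lbound.
(* Schmidt rank a^(n+1), with the local isometry V^(x)(n+1) as channel. *)
exists (iter n.+1 (muln a) 1%N),
  (fun X => (1%:M *t tens_pow V n.+1) *m X *m (1%:M *t tens_pow V n.+1)^t*).
split.
- by rewrite iter_muln expn_gt0 a_gt0.
- by apply: ppt_channel_isometry; [exact: tens_pow_real|exact: tens_pow_isometry].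
- exact: bitens_pow_isometric_state.
- by rewrite iter_muln natrX /log2 lnXn ?ltr0n // -(mulr_natl (ln _)) mulrA.
Qed.

Lemma isometric_state_is_state a b (V : 'M[C]_(b, a)) :
  (0 < a)%N -> (forall i j, V i j \is Num.real) -> V^t* *m V = 1%:M ->
  is_state (isometric_state V).
Proof.
move=> a_gt0 Vreal Viso; split.
  (* The state is pure: [w] is the vectorization of [V], and the state is w w^* / a. *)
  pose w : 'cV[C]_(a * b) := \col_x V (mxtens_unindex x).2 (mxtens_unindex x).1.
  have -> : isometric_state V = a%:R^-1 *: (w *m 1%:M *m w^t*).
    apply: eq_mxtens => i j k l; rewrite isometric_stateE // mulmx1 !mxE.
    by rewrite big_ord1 !mxE !mxtens_indexK conj_Creal // mulrA.
  by apply: psdZ; [rewrite invr_ge0 ler0n|exact/psd_conj/psd1].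
(* Trace preservation reduces the trace to that of the maximally entangled state. *)
rewrite (ppt_channel_isometry Vreal Viso a).1.2 /mxtrace sum_mxtens.
transitivity (\sum_(i < a) a%:R^-1 : C).
  apply: eq_bigr => i _; rewrite (bigD1 i) //= big1 ?addr0.
    by rewrite max_entangledE !eqxx mulr1.
  by move=> j /negPf nj; rewrite max_entangledE eq_sym nj mulr0.
by rewrite sumr_const card_ord -[RHS](@mulfV _ a%:R) ?pnatr_eq0 -?lt0n // mulr_natl.
Qed.

(** * The three-qubit example *)

Lemma sum2 (V : nmodType) (F : 'I_2 -> V) : \sum_i F i = F 0 + F 1.
Proof. by rewrite big_ord_recl big_ord1; congr (_ + F _); apply/val_inj. Qed.

(** Rows run over |00>, |01>, |10>, |11> of BC. For amplitudes c, s with c^2 + s^2 = 1 in place of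
    3/5, 4/5, the partial transposes of the marginals have trace norms 1 + c^2 and 1 + s^2, with
    product 2 + c^2 s^2. A rational point of the circle keeps the sign matrices rational too. *)
Definition branch_iso : 'M[C]_(2 * 2, 2) :=
  \matrix_(x, i) nth 0 (nth [::]
    [:: [:: 3/5; 0]; [:: 0; 0]; [:: 0; 1]; [:: 4/5; 0]] x) i.

(* The signs of the partial transposes of the marginals on AB and AC: in the basis
   |00>, |01>, |10>, |11> the former is [[16/25, 3/5], [3/5, 0]] / 2 on the span of |01>
   and |10>, with eigenvalues 1/2 and - 9/50, and it is positive diagonal elsewhere; the
   latter has an analogous block on the span of |00> and |11>. *)
Definition sign_ab : 'M[C]_(2 * 2) :=
  \matrix_(x, y) nth 0 (nth [::]
    [:: [:: 1; 0; 0; 0]; [:: 0; 8/17; 15/17; 0];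
        [:: 0; 15/17; - (8/17); 0]; [:: 0; 0; 0; 1]] x) y.

Definition sign_ac : 'M[C]_(2 * 2) :=
  \matrix_(x, y) nth 0 (nth [::]
    [:: [:: 9/41; 0; 0; 40/41]; [:: 0; 1; 0; 0];
        [:: 0; 0; 1; 0]; [:: 40/41; 0; 0; - (9/41)]] x) y.

Lemma ord2_ind (P : 'I_2 -> Prop) : P 0 -> P 1 -> forall i, P i.
Proof.
move=> P0 P1 [[|[|//]] lti].
  by rewrite (_ : Ordinal lti = 0) //; apply/val_inj.
by rewrite (_ : Ordinal lti = 1) //; apply/val_inj.
Qed.

Lemma branch_iso_real i j : branch_iso i j \is Num.real.
Proof.
rewrite mxE.
case: i => [[|[|[|[|//]]]] ?]; case: j => [[|[|//]] ?];
by rewrite /= ?rpred0 ?rpred1 ?rpred_div ?realn.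
Qed.

Lemma branch_iso_iso : branch_iso^t* *m branch_iso = 1%:M.
Proof.
have -> : branch_iso^t* = branch_iso^T.
  by apply/matrixP => i x; rewrite mxE [(_^T)%R _ _]mxE conj_Creal ?branch_iso_real // mxE.
apply/matrixP; do 2![apply: ord2_ind];
by rewrite mxE sum_mxtens !sum2 !mxE /=; field.
Qed.

Lemma sign_ab_adj : sign_ab^t* = sign_ab.
Proof.
apply/matrixP => x y; rewrite !mxE.
case: x => [[|[|[|[|//]]]] ?]; case: y => [[|[|[|[|//]]]] ?];
by rewrite /= conj_Creal // ?rpredN ?rpred0 ?rpred1 ?rpred_div ?realn.
Qed.

Lemma sign_ab_sqr : sign_ab *m sign_ab = 1%:M.
Proof.
apply: eq_mxtens; do 4![apply: ord2_ind];
by rewrite -tens1mx1 tensmxE [LHS]mxE sum_mxtens !sum2 !mxE /=; field.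
Qed.

Lemma tr_sign_ab : \tr (sign_ab *m partial_transpose (trace_C (isometric_state branch_iso))) = (34/25)%:C.
Proof.
rewrite /mxtrace sum_mxtens.
under eq_bigr do under eq_bigr do rewrite mxE sum_mxtens.
under eq_bigr do under eq_bigr do under eq_bigr do under eq_bigr do
  rewrite partial_transposeE [trace_C _ _ _]mxE !mxtens_indexK.
rewrite !sum2 !(isometric_stateE branch_iso_real) fmorph_div !rmorph_nat.
rewrite !mxE /=.
by field.
Qed.

Lemma sign_ac_adj : sign_ac^t* = sign_ac.
Proof.
apply/matrixP => x y; rewrite !mxE.
case: x => [[|[|[|[|//]]]] ?]; case: y => [[|[|[|[|//]]]] ?];
by rewrite /= conj_Creal // ?rpredN ?rpred0 ?rpred1 ?rpred_div ?realn.
Qed.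

Lemma sign_ac_sqr : sign_ac *m sign_ac = 1%:M.
Proof.
apply: eq_mxtens; do 4![apply: ord2_ind];
by rewrite -tens1mx1 tensmxE [LHS]mxE sum_mxtens !sum2 !mxE /=; field.
Qed.

Lemma tr_sign_ac : \tr (sign_ac *m partial_transpose (trace_B (isometric_state branch_iso))) = (41/25)%:C.
Proof.
rewrite /mxtrace sum_mxtens.
under eq_bigr do under eq_bigr do rewrite mxE sum_mxtens.
under eq_bigr do under eq_bigr do under eq_bigr do under eq_bigr do
  rewrite partial_transposeE [trace_B _ _ _]mxE !mxtens_indexK.
rewrite !sum2 !(isometric_stateE branch_iso_real) fmorph_div !rmorph_nat.
rewrite !mxE /=.
by field.
Qed.

End Cost.

(* The type 'M_(a * (b * c)) of rho is that of a bipartite operator for the cut A | BC. *)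
Theorem proposition4 (R : realType) :
  exists (a b c : nat) (rho : 'M[R[i]]_(a * (b * c))),
    is_state rho /\
    (ppt_cost rho < ppt_cost (trace_C rho) + ppt_cost (trace_B rho))%E.
Proof.
exists 2%N, 2%N, 2%N, (isometric_state (branch_iso R)).
have Vreal := @branch_iso_real R; have Viso := branch_iso_iso R.
split; first exact: isometric_state_is_state.
apply: le_lt_trans (ppt_cost_isometric_state_le _ Vreal Viso) _ => //.
(* Stated at [n.+1], so that 33 and 40 yield the positivity of 34/25 and 41/25. *)
have pos (n : nat) : 0 < n.+1%:R / 25 :> R by rewrite divr_gt0 ?ltr0n.
have ge_ab := ppt_cost_ge (pos 33%N) (sign_ab_adj R) (sign_ab_sqr R) (tr_sign_ab R).
have ge_ac := ppt_cost_ge (pos 40%N) (sign_ac_adj R) (sign_ac_sqr R) (tr_sign_ac R).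
apply: lt_le_trans (leeD ge_ab ge_ac).
(* Cancelling 1 / ln 2 and merging the logarithms leaves 2 < (34/25)(41/25) = 1394/625. *)
rewrite -EFinD lte_fin /log2 -mulrDl ltr_pM2r ?invr_gt0 ?ln2_gt0 //.
rewrite -lnM ?posrE ?pos // ltr_ln ?posrE ?mulr_gt0 ?pos ?ltr0n //.
lra.
Qed.
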